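(* Let $p\geq2$, $r\geq1$ and $n\geq1$. Then $rad(O\Gamma_{n}^{(p,r)})=\lceil \frac{nr}{pr+1}\rceil$, and: (1) if $n \bmod (pr+1)\neq kp+1$ for every integer $k\geq0$, then $\mathcal{Z}(O\Gamma_{n}^{(p,r)})=\{0^{n}\}$; (2) if $n\bmod (pr+1)=kp+1$ for some integer $k\geq0$, then $|\mathcal{Z}(O\Gamma_{n}^{(p,r)})|=(\lfloor\frac{n}{pr+1}\rfloor+1)(k+1)+1$, and, when $n>pr+1$, $\mathcal{Z}(O\Gamma_{n}^{(p,r)})=\{0^{pr+1}c,\ c0^{pr+1} : c\in\mathcal{Z}(O\Gamma_{n-pr-1}^{(p,r)})\}$.
   Context: For positive integers $n,p,r$, $O\Gamma_{n}^{(p,r)}$ is the graph whose vertices are the binary words of length $n$ in which any two $1$s are separated by at least $p-1$ zeros and which contain no factor $(10^{p-1})^{r}1$ (no more than $r$ ones each separated from the next by exactly $p-1$ zeros); two vertices are adjacent iff they differ in exactly one coordinate. $0^s$ denotes a run of $s$ zeros; products denote concatenation. For a connected graph $G$, $e(v)=\max_u d(v,u)$, $rad(G)=\min_v e(v)$, and the center $\mathcal{Z}(G)$ is the set of vertices with $e(v)=rad(G)$. *)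

(* Defs.v *)
From mathcomp Require Import all_boot all_order all_algebra.

Set Implicit Arguments.
Unset Strict Implicit.
Unset Printing Implicit Defensive.

(* A finite graph is given by its adjacency relation [e : rel T]. *)
Section GraphCenter.
Variables (T : finType) (e : rel T).

Definition walk_of_length (x y : T) (m : nat) : bool :=
  [exists s : m.-tuple T, path e x s && (last x s == y)].

(* A shortest walk has fewer than #|T| steps; pairs of vertices in distinct
   components are conventionally at distance #|T|. *)
Definition gdist (x y : T) : nat :=
  find (walk_of_length x y) (iota 0 #|T|).

Definition eccentricity (v : T) : nat := \max_(u : T) gdist v u.

(* Eccentricities are at most #|T|, so for T nonempty the default value #|T|
   does not affect the minimum. *)
Definition radius : nat := \big[minn/#|T|]_(v : T) eccentricity v.

Definition center : {set T} := [set v | eccentricity v == radius].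

End GraphCenter.

(* The number of 0s strictly between positions i and j of w, for i < j. *)
Definition zeros_between (w : seq bool) (i j : nat) : nat :=
  count_mem false (take (j - i.+1) (drop i.+1 w)).

Definition ones_separated (p : nat) (w : seq bool) : bool :=
  [forall i : 'I_(size w), forall j : 'I_(size w),
    [&& i < j, nth false w i & nth false w j] ==>
      (p.-1 <= zeros_between w i j)].

(* (1 0^(p-1))^r 1 *)
Definition forbidden_factor (p r : nat) : seq bool :=
  flatten (nseq r (true :: nseq p.-1 false)) ++ [:: true].

Definition og_word (p r : nat) (w : seq bool) : bool :=
  ones_separated p w && ~~ infix (forbidden_factor p r) w.

Definition og_vertex (p r n : nat) := {w : n.-tuple bool | og_word p r w}.

Definition og_adj (p r n : nat) : rel (og_vertex p r n) :=
  fun u v => #|[set i : 'I_n | tnth (val u) i != tnth (val v) i]| == 1.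

Definition og_radius (p r n : nat) : nat := radius (@og_adj p r n).

Definition og_center (p r n : nat) : {set og_vertex p r n} :=
  center (@og_adj p r n).

(* The center as a list of words, so that centers for different lengths n can
   be compared; to be used up to =i. *)
Definition og_center_words (p r n : nat) : seq (seq bool) :=
  [seq tval (val v) | v in og_center p r n].

Definition zeros (s : nat) : seq bool := nseq s false.

(* Main.v *)
(* Admissible words are closed under erasing ones, so distances in the graph are
   Hamming distances and the eccentricity of v is the maximum of the Hamming
   distances to v. Write L = p r + 1. A window of length L contains at most r
   ones and a window of length p at most one, which gives the maximal weight M;
   it is the eccentricity of the zero word. For v nonzero, erasing the ones of v
   from a word u of weight M gives distance |u or v|, so the eccentricity of v
   exceeds M as soon as some word of weight M misses a one of v. Hence a central
   word has ones only at positions common to all words of weight M. Explicit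
   L-periodic words show that there are none unless n mod L = k p + 1, in which
   case they are the L i + p j with j <= k. A word with a single one there is
   central; one with several is at distance more than M from a periodic word of
   weight M - 1 that avoids all these positions. *)

Require Import Defs.
From mathcomp Require Import all_boot all_order all_algebra.
From mathcomp Require Import zify.

Set Implicit Arguments.
Unset Strict Implicit.
Unset Printing Implicit Defensive.

(** * Distances in finite graphs *)

Lemma walk_of_lengthP (T : finType) (e : rel T) (x y : T) (m : nat) :
  reflect (exists s, [/\ path e x s, last x s = y & size s = m])
          (walk_of_length e x y m).
Proof.
apply: (iffP existsP) => [[s /andP[ps /eqP ls]]|[s [ps ls ss]]].
  by exists s; rewrite size_tuple.
by exists (Tuple (introT eqP ss)); rewrite /= ps ls eqxx.
Qed.

Lemma gdist_le_card (T : finType) (e : rel T) (x y : T) : gdist e x y <= #|T|.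
Proof. by have := find_size (walk_of_length e x y) (iota 0 #|T|); rewrite size_iota. Qed.

Lemma gdist_eq (T : finType) (e : rel T) (x y : T) (d : nat) :
    (forall s, path e x s -> last x s = y -> d <= size s) ->
    (exists s, [/\ path e x s, last x s = y & size s = d]) ->
  gdist e x y = d.
Proof.
move=> dmin [s [ps ls ss]].
(* Cutting the loops out of the walk leaves distinct vertices, at least d + 1 of them, so d lies in
   the range searched by [gdist]. *)
have ltd : d < #|T|.
  case/shortenP: ps ls => s' ps' us' _ ls'.
  have := max_card (mem (x :: s')).
  rewrite (card_uniqP us') /= => h.
  by apply: leq_trans h; rewrite ltnS dmin.
have hasd : has (walk_of_length e x y) (iota 0 #|T|).
  apply/hasP; exists d; first by rewrite mem_iota.
  by apply/walk_of_lengthP; exists s.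
have := nth_find 0 hasd; rewrite -/(gdist e x y).
have ltg : gdist e x y < #|T| by rewrite -[X in _ < X](size_iota 0) -has_find.
rewrite nth_iota // add0n => /walk_of_lengthP[s' [ps' ls' ss']].
apply/eqP; rewrite eqn_leq -{2}ss' dmin // andbT leqNgt; apply/negP => ltdg.
have := before_find 0 ltdg; rewrite nth_iota // add0n => /walk_of_lengthP[].
by exists s.
Qed.

Lemma bigminn_leq (I : eqType) (d : nat) (s : seq I) (F : I -> nat) (x : I) :
  x \in s -> \big[minn/d]_(i <- s) F i <= F x.
Proof.
elim: s => // a s IH; rewrite inE big_cons => /orP[/eqP->|/IH h].
  exact: geq_minl.
exact: leq_trans (geq_minr _ _) h.
Qed.

Lemma radius_eq (T : finType) (e : rel T) (x : T) (m : nat) :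
    (forall v, m <= eccentricity e v) -> eccentricity e x = m ->
  radius e = m.
Proof.
move=> mle ex; apply/eqP; rewrite eqn_leq; apply/andP; split.
  by rewrite -ex; apply: bigminn_leq; rewrite mem_index_enum.
rewrite /radius; elim/big_ind: _ => [|a b ma mb|v _]; last exact: mle.
  (* The default value [#|T|] is also at least m, since m is itself an eccentricity. *)
  by rewrite -ex; apply/bigmax_leqP => u _; exact: gdist_le_card.
by rewrite leq_min ma.
Qed.

(** * Admissible sets of positions *)

Lemma count_iota_card (n : nat) (P : pred nat) :
  #|[set i : 'I_n | P i]| = count P (iota 0 n).
Proof.
rewrite -val_enum_ord count_map -sum1_card -sum1_count big_enum_cond /=.
by apply: eq_bigl => i; rewrite !inE.
Qed.

Lemma sub_in_count (T : eqType) (s : seq T) (a1 a2 : pred T) :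
  {in s, forall x, a1 x -> a2 x} -> count a1 s <= count a2 s.
Proof.
elim: s => //= x s IH h; apply: leq_add.
  by have := h x (mem_head _ _); case: (a1 x) => // ->.
by apply: IH => y ys; apply: h; rewrite inE ys orbT.
Qed.

Lemma count_le1 (T : eqType) (s : seq T) (P : pred T) :
    uniq s -> {in s &, forall x y, P x -> P y -> x = y} ->
  count P s <= 1.
Proof.
move=> us h; rewrite -size_filter.
have uf := filter_uniq P us.
case ef : (filter P s) => [|x [|y t]] //.
have xf : x \in filter P s by rewrite ef mem_head.
have yf : y \in filter P s by rewrite ef !inE eqxx orbT.
move: xf yf uf; rewrite !mem_filter ef /= => /andP[Px xs] /andP[Py ys].
by rewrite (h x y) // mem_head.
Qed.

(** Working with sets of positions frees the condition from the length n and turns erasing ones into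
    passing to a subset. Under the separation clause, a forbidden factor amounts to r + 1 ones in
    progression with step p, the letters between them being forced to 0. *)
Definition admissible (p r : nat) (P : pred nat) : Prop :=
  (forall x y, P x -> P y -> x < y -> x + p <= y) /\
  (forall x, ~ (forall j, j <= r -> P (x + p * j))).

Lemma admissible_sub (p r : nat) (P Q : pred nat) :
  subpred Q P -> admissible p r P -> admissible p r Q.
Proof.
move=> QP [sep run]; split=> [x y /QP Px /QP Py|x h]; first exact: sep.
by apply: (run x) => j /h /QP.
Qed.

Lemma size_forbidden_factor (p r : nat) :
  0 < p -> size (forbidden_factor p r) = (p * r).+1.
Proof.
case: p => // p _; rewrite size_cat addn1 size_flatten /shape map_nseq sumn_nseq.
by rewrite /= size_nseq.
Qed.

Lemma nth_forbidden_factor (p r i : nat) :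
  0 < p -> i <= p * r -> nth false (forbidden_factor p r) i = (p %| i).
Proof.
case: p => // p _; elim: r i => [|r IH] i.
  by rewrite muln0 leqn0 => /eqP->.
rewrite mulnS => hi; rewrite /forbidden_factor /= -catA.
rewrite -cat_cons nth_cat /= size_nseq; case: ltnP => hip.
  case: i hi hip => // i _ hip; rewrite /= nth_nseq.
  by rewrite -ltnS hip gtnNdvd.
rewrite IH; last by lia.
by rewrite -{2}(subnK hip) dvdn_addl.
Qed.

Lemma og_wordP (p r : nat) (w : seq bool) : 0 < p ->
  reflect (admissible p r (nth false w)) (og_word p r w).
Proof.
move=> p0; have ltsz x : nth false w x -> x < size w.
  by case: ltnP => // h; rewrite nth_default.
apply: (iffP andP) => [[/forallP sep /negP run]|[sep run]].
  have sep' x y : nth false w x -> nth false w y -> x < y -> x + p <= y.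
    move=> wx wy ltxy.
    have /forallP /(_ (Ordinal (ltsz _ wy))) := sep (Ordinal (ltsz _ wx)).
    rewrite /= ltxy wx wy /= => h.
    have := leq_trans h (count_size _ _).
    rewrite size_take; case: ifP; lia.
  split=> // x h; apply: run; apply/infixP.
  exists (take x w), (drop (p * r).+1 (drop x w)).
  have lt : x + p * r < size w by apply/ltsz/h.
  rewrite -{1}(cat_take_drop x w) -{1}(cat_take_drop (p * r).+1 (drop x w)).
  congr (_ ++ (_ ++ _)).
  have sz : size (take (p * r).+1 (drop x w)) = (p * r).+1.
    by rewrite size_takel // size_drop; lia.
  apply: (@eq_from_nth _ false); first by rewrite sz size_forbidden_factor.
  move=> i; rewrite sz => hi; rewrite nth_take // nth_drop nth_forbidden_factor //.
  (* Position i comes less than p after the one at [p * (i %/ p)], so it is a zero unless p divides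
     i. *)
  have hd : p * (i %/ p) <= p * r.
    by rewrite mulnC; apply: leq_trans (leq_trunc_div _ _) _.
  have wd : nth false w (x + p * (i %/ p)) by apply: h; rewrite leq_pmul2l // in hd.
  have Di := divn_eq i p; have mi := ltn_pmod i p0.
  rewrite /dvdn; case: eqP => [m0|m0].
    by rewrite Di m0 addn0 mulnC.
  apply/negP => wi; have := sep' _ _ wd wi; lia.
split.
  apply/forallP => i; apply/forallP => j; apply/implyP => /and3P[ij wi wj].
  have le := sep _ _ wi wj ij.
  rewrite /zeros_between.
  (* The first p - 1 letters after i suffice: separation makes all of them zero and puts them before
     j. *)
  have -> : j - i.+1 = p.-1 + (j - i - p) by lia.
  rewrite takeD count_cat; apply: leq_trans (leq_addr _ _).
  have sz : size (take p.-1 (drop i.+1 w)) = p.-1.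
    by rewrite size_takel // size_drop; have := ltsz _ wj; lia.
  rewrite -{1}sz leq_eqVlt eq_sym -all_count; apply/orP; left.
  apply/(all_nthP false) => k; rewrite sz => hk; rewrite nth_take // nth_drop.
  rewrite /= eqbF_neg; apply/negP => wk.
  have := sep _ _ wi wk; lia.
apply/negP => /infixP[s [s' Dw]]; apply: (run (size s)) => j jr.
rewrite Dw nth_cat -ltn_subRL subnn ltn0 addKn nth_cat size_forbidden_factor //.
have hj : p * j <= p * r by rewrite leq_mul2l jr orbT.
by rewrite ltnS hj nth_forbidden_factor // dvdn_mulr.
Qed.

Lemma count_window (p r a : nat) (P : pred nat) :
  admissible p r P -> count P (iota a p) <= 1.
Proof.
move=> [sep _]; apply: count_le1 (iota_uniq _ _) _ => x y.
rewrite !mem_iota => hx hy Px Py.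
by have := sep x y Px Py; have := sep y x Py Px; lia.
Qed.

Lemma count_windows (p r t a : nat) (P : pred nat) :
  admissible p r P -> count P (iota a (p * t)) <= t.
Proof.
move=> adm; elim: t a => [|t IH] a; first by rewrite muln0.
rewrite mulnS iotaD count_cat -add1n leq_add ?IH //.
exact: count_window adm.
Qed.

(* If r + 1 ones fit into the window, some a + p t with t <= r is a zero, and
   removing it leaves r windows of length p. *)
Lemma count_block (p r a : nat) (P : pred nat) :
  admissible p r P -> count P (iota a (p * r + 1)) <= r.
Proof.
move=> adm; have [_ run] := adm.
case: (boolP (all (fun j => P (a + p * j)) (iota 0 r.+1))) => [/allP h|].
  by case: (run a) => j jr; apply: h; rewrite mem_iota.
case/allPn => t; rewrite mem_iota add0n ltnS => /= tr nPt.
have -> : p * r + 1 = p * t + (1 + p * (r - t)).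
  by rewrite addnCA -mulnDr subnKC // addnC.
rewrite !iotaD !count_cat /= (negbTE nPt) add0n.
rewrite -{2}(subnKC tr); apply: leq_add; exact: count_windows adm.
Qed.

Lemma count_blocks (p r q a : nat) (P : pred nat) :
  admissible p r P -> count P (iota a ((p * r + 1) * q)) <= q * r.
Proof.
move=> adm; elim: q a => [|q IH] a; first by rewrite muln0.
rewrite mulnS iotaD count_cat mulSn leq_add ?IH //.
exact: count_block adm.
Qed.

(** * Distances are Hamming distances *)

Definition ones (p r n : nat) (u : og_vertex p r n) : pred nat :=
  nth false (tval (val u)).

Lemma ones_lt (p r n : nat) (u : og_vertex p r n) (x : nat) : ones u x -> x < n.
Proof.
by rewrite /ones; case: ltnP => // h; rewrite nth_default // size_tuple.
Qed.

Lemma ones_inj (p r n : nat) (u v : og_vertex p r n) : ones u =1 ones v -> u = v.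
Proof.
move=> uv; apply/val_inj/val_inj/(@eq_from_nth _ false).
  by rewrite !size_tuple.
by move=> i _; exact: uv.
Qed.

Lemma admissible_ones (p r n : nat) (u : og_vertex p r n) :
  0 < p -> admissible p r (ones u).
Proof. by move=> p0; apply/og_wordP => //; exact: (valP u). Qed.

(** Cutting an admissible set off at n only removes ones; the witness vertices below all come from
    here. *)
Lemma exists_vertex (p r n : nat) (P : pred nat) :
    0 < p -> admissible p r P ->
  exists u : og_vertex p r n, forall x, ones u x = (x < n) && P x.
Proof.
move=> p0 adm.
have nthE x : nth false (mkseq P n) x = (x < n) && P x.
  by case: ltnP => h; [rewrite nth_mkseq | rewrite nth_default // size_mkseq].
have szP : size (mkseq P n) == n by rewrite size_mkseq.
have ogP : og_word p r (Tuple szP).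
  apply/og_wordP => //; apply: admissible_sub adm => x.
  by rewrite /= nthE => /andP[].
by exists (Sub (Tuple szP) ogP) => x; rewrite /ones SubK /= nthE.
Qed.

Definition hamming (p r n : nat) (u v : og_vertex p r n) : nat :=
  count (fun x => ones u x != ones v x) (iota 0 n).

Lemma og_adjE (p r n : nat) (u v : og_vertex p r n) :
  og_adj u v = (hamming u v == 1).
Proof.
rewrite /og_adj /hamming -count_iota_card; congr (#|pred_of_set _| == 1).
by apply/setP => i; rewrite !inE /ones !(tnth_nth false).
Qed.

Lemma hamming_triangle (p r n : nat) (u v w : og_vertex p r n) :
  hamming u w <= hamming u v + hamming v w.
Proof.
rewrite /hamming -count_predUI; apply: leq_trans (leq_addr _ _).
by apply: sub_count => x /=; do 3!case: (ones _ x).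
Qed.

Lemma hamming_eq0 (p r n : nat) (u v : og_vertex p r n) :
  (hamming u v == 0) = (u == v).
Proof.
apply/idP/eqP => [|->]; last first.
  rewrite /hamming (eq_count (a2 := pred0)) ?count_pred0 // => x.
  by rewrite /= eqxx.
rewrite -leqn0 leqNgt -has_count => /hasPn h; apply: ones_inj => x.
case: (ltnP x n) => xn.
  by have := h x; rewrite mem_iota /= negbK => /(_ xn) /eqP.
by apply/idP/idP => /ones_lt; rewrite ltnNge xn.
Qed.

(* Moving from u to v, first erase the ones of u missing in v, then add those
   of v missing in u: every intermediate set of ones lies inside one of the
   two, so all these words are vertices. *)
Lemma hamming_step (p r n : nat) (u v : og_vertex p r n) :
  0 < p -> u != v ->
  exists w : og_vertex p r n, og_adj u w /\ hamming u v = (hamming w v).+1.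
Proof.
move=> p0 uv.
have [x [xn xD aw]] : exists x, [/\ x < n, ones u x != ones v x &
    admissible p r (fun i => if i == x then ~~ ones u i else ones u i)].
  case: (boolP (has (fun i => ones u i && ~~ ones v i) (iota 0 n))).
    move=> /hasP[x]; rewrite mem_iota => /= xn /andP[ux nvx]; exists x.
    split=> //; first by rewrite ux (negbTE nvx).
    apply: admissible_sub (admissible_ones u p0) => i /=.
    by case: eqP => // ->; rewrite ux.
  move=> /hasPn sub.
  have suv i : ones u i -> ones v i.
    move=> ui; have := sub i; rewrite mem_iota /= (ones_lt ui) ui /= negbK.
    by apply.
  move: uv; rewrite -hamming_eq0 -lt0n -has_count => /hasP[x].
  rewrite mem_iota => /= xn xD; exists x; split=> //.
  apply: admissible_sub (admissible_ones v p0) => i /=.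
  case: eqP => [->|_]; last exact: suv.
  by move: xD; case: (ones u x); case: (ones v x).
have [w wE] := exists_vertex n p0 aw.
have cnt1 : count (pred1 x) (iota 0 n) = 1.
  by rewrite count_uniq_mem ?iota_uniq // mem_iota xn.
exists w; split.
  rewrite og_adjE /hamming -[X in _ == X]cnt1; apply/eqP/eq_in_count => i.
  rewrite mem_iota /= wE => -> /=; case: (i =P x) => _; last by rewrite eqxx.
  by case: (ones u i).
(* The differences of u and v are those of w and v together with x, which is not among the
   latter. *)
rewrite /hamming -addn1 -cnt1 -count_predUI.
rewrite [X in _ = _ + X](eq_count (a2 := pred0)) ?count_pred0 ?addn0.
  apply: eq_in_count => i; rewrite mem_iota /= wE => -> /=.
  case: (i =P x) => [->|_]; last by rewrite orbF.
  by rewrite orbT xD.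
move=> i /=; rewrite wE andbC; case: (i =P x) => //= ->; rewrite xn /=.
by move: xD; case: (ones u x); case: (ones v x).
Qed.

(** An edge changes the Hamming distance by at most one, so no walk is shorter; iterating
    [hamming_step] gives a walk of exactly this length. *)
Lemma gdist_hamming (p r n : nat) (u v : og_vertex p r n) :
  0 < p -> gdist (@og_adj p r n) u v = hamming u v.
Proof.
move=> p0; apply: gdist_eq.
  move=> s; elim: s u => [|w s IH] u /=.
    by move=> _ ->; rewrite leqn0 hamming_eq0.
  rewrite og_adjE => /andP[/eqP uw /IH{}IH] /IH wv.
  by apply: leq_trans (hamming_triangle u w v) _; rewrite uw ltnS.
have [d] := ubnP (hamming u v); elim: d u => // d IH u.
case: (eqVneq u v) => [<- _|uv].
  by exists [::]; split=> //=; apply/esym/eqP; rewrite hamming_eq0.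
have [w [uw ->]] := hamming_step p0 uv; rewrite ltnS => /IH[s [ps ls ss]].
by exists (w :: s); rewrite /= uw ps ls ss.
Qed.

Lemma hamming_le_ecc (p r n : nat) (u v : og_vertex p r n) :
  0 < p -> hamming u v <= eccentricity (@og_adj p r n) v.
Proof.
move=> p0; have := leq_bigmax (F := gdist (@og_adj p r n) v) u.
rewrite gdist_hamming //; congr (_ <= _); apply: eq_count => x.
by rewrite eq_sym.
Qed.

Lemma ecc_leP (p r n M : nat) (v : og_vertex p r n) : 0 < p ->
  reflect (forall u : og_vertex p r n, hamming u v <= M)
          (eccentricity (@og_adj p r n) v <= M).
Proof.
move=> p0; apply: (iffP idP) => [h u|h].
  exact: leq_trans (hamming_le_ecc u v p0) h.
apply/bigmax_leqP => u _; rewrite gdist_hamming //.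
by have := h u; congr (_ <= _); apply: eq_count => x; rewrite eq_sym.
Qed.

(* The witness is u with the ones of v erased. *)
Lemma count_union_le_ecc (p r n : nat) (u v : og_vertex p r n) : 0 < p ->
  count (predU (ones u) (ones v)) (iota 0 n) <= eccentricity (@og_adj p r n) v.
Proof.
move=> p0.
have adm : admissible p r (fun x => ones u x && ~~ ones v x).
  by apply: admissible_sub (admissible_ones u p0) => x /andP[].
have [w wE] := exists_vertex n p0 adm.
apply: leq_trans (hamming_le_ecc w v p0).
apply: sub_in_count => x; rewrite mem_iota /= wE => -> /=.
by case: (ones u x); case: (ones v x).
Qed.

(** * Words of maximal weight and the center *)

(** Cut into q blocks of length p r + 1 and a remainder covered by s windows of length p. *)
Lemma count_le_max_weight (p r q m s : nat) (P : pred nat) :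
    admissible p r P -> m <= p * s ->
  count P (iota 0 ((p * r + 1) * q + m)) <= q * r + s.
Proof.
move=> adm ms; rewrite iotaD count_cat leq_add ?(count_blocks _ _ adm) //.
apply: leq_trans (count_windows s (0 + (p * r + 1) * q) adm).
by rewrite -(subnKC ms) iotaD count_cat leq_addr.
Qed.

(* Removing the zero at the critical position leaves q blocks of length p r + 1
   and k windows of length p. *)
Lemma count_le_zero_at_critical (p r q k i j : nat) (P : pred nat) :
    admissible p r P -> i <= q -> j <= k -> ~~ P ((p * r + 1) * i + p * j) ->
  count P (iota 0 ((p * r + 1) * q + (p * k + 1))) <= q * r + k.
Proof.
move=> adm iq jk nP.
have -> : (p * r + 1) * q + (p * k + 1) =
    (p * r + 1) * i + (p * j + (1 + ((p * r + 1) * (q - i) + p * (k - j)))).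
  have := mulnDr (p * r + 1) i (q - i); rewrite subnKC // => ->.
  by have := mulnDr p j (k - j); rewrite subnKC // => ->; lia.
rewrite !iotaD !count_cat /= add0n (negbTE nP) add0n.
have h1 := count_blocks i 0 adm.
have h2 := count_windows j ((p * r + 1) * i) adm.
have h3 := count_blocks (q - i) ((p * r + 1) * i + p * j + 1) adm.
have h4 := count_windows (k - j)
  ((p * r + 1) * i + p * j + 1 + (p * r + 1) * (q - i)) adm.
have := mulnBl q i r; have := leq_mul iq (leqnn r); lia.
Qed.

(* The (r i + j)-th one is at position (p r + 1) i + p j, shifted by one when
   c <= j: in each period the single gap longer than p comes just before the
   one of index c (c = 0 or c = r: at the end of the period). *)
Definition pattern (p r c : nat) : pred nat :=
  fun x => has (fun j => x %% (p * r + 1) == p * j + (c <= j)) (iota 0 r).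

Lemma patternP (p r c x : nat) :
  reflect (exists2 j, j < r & x %% (p * r + 1) = p * j + (c <= j))
          (pattern p r c x).
Proof.
apply: (iffP hasP) => [[j]|[j jr /eqP xj]].
  by rewrite mem_iota => /= jr /eqP xj; exists j.
by exists j; rewrite // mem_iota.
Qed.

(** A run of r + 1 ones from x would end at x + p r, next to the one that periodicity puts at x + p
    r + 1; separation excludes this since p > 1. *)
Lemma admissible_pattern (p r c : nat) : 1 < p -> admissible p r (pattern p r c).
Proof.
move=> p1.
have sep x y : pattern p r c x -> pattern p r c y -> x < y -> x + p <= y.
  move=> /patternP[j jr xj] /patternP[j' jr' yj'].
  rewrite (divn_eq x (p * r + 1)) (divn_eq y (p * r + 1)) xj yj'.
  set a := x %/ _; set b := y %/ _; set L := p * r + 1.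
  (* Even when shifted, a one of index j < r stays at least p before the start of the next
     period. *)
  have hj : p * j + p <= p * r by rewrite addnC -mulnS leq_mul2l jr orbT.
  case: (ltngtP a b) => [ab|ba|<-].
  - have : a * L + L <= b * L by rewrite addnC -mulSn leq_mul2r ab orbT.
    by lia.
  - have : b * L + L <= a * L by rewrite addnC -mulSn leq_mul2r ba orbT.
    have : p * j' + p <= p * r by rewrite addnC -mulnS leq_mul2l jr' orbT.
    by lia.
  - case: (ltnP j j') => [jj'|j'j].
      have : p * j + p <= p * j' by rewrite addnC -mulnS leq_mul2l jj' orbT.
      by lia.
    have : p * j' <= p * j by rewrite leq_mul2l j'j orbT.
    by lia.
split=> // x run.
have Px : pattern p r c x by have := run 0 isT; rewrite muln0 addn0.
have PL : pattern p r c (x + p * r + 1).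
  by rewrite -addnA /pattern modnDr.
have := sep _ _ (run r (leqnn r)) PL; lia.
Qed.

(** The first s ones of the i-th period, listed by [f], are distinct and lie in its first m
    positions. *)
Lemma count_pattern_block (p r c i m s : nat) :
    0 < p -> s <= r -> m <= p * r + 1 ->
    (forall j, j < s -> p * j + (c <= j) < m) ->
  s <= count (pattern p r c) (iota ((p * r + 1) * i) m).
Proof.
move=> p0 sr mL hs; rewrite -{1}(size_iota 0 s) -size_filter.
pose f j := (p * r + 1) * i + (p * j + (c <= j)).
rewrite -(size_map f); apply: uniq_leq_size.
  rewrite map_inj_uniq ?iota_uniq // => j j' /addnI fE.
  case: (ltngtP j j') => // h.
    have : p * j + p <= p * j' by rewrite addnC -mulnS leq_mul2l h orbT.
    by lia.
  have : p * j' + p <= p * j by rewrite addnC -mulnS leq_mul2l h orbT.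
  by lia.
move=> x /mapP[j]; rewrite mem_iota => /= js ->.
rewrite mem_filter mem_iota leq_addr ltn_add2l hs // !andbT.
apply/patternP; exists j; first exact: leq_trans sr.
by rewrite /f mulnC modnMDl modn_small // (leq_trans (hs j js)).
Qed.

Lemma count_pattern (p r c q m s : nat) :
    0 < p -> s <= r -> m <= p * r + 1 ->
    (forall j, j < s -> p * j + (c <= j) < m) ->
  q * r + s <= count (pattern p r c) (iota 0 ((p * r + 1) * q + m)).
Proof.
move=> p0 sr mL hs; rewrite iotaD count_cat leq_add ?count_pattern_block //.
elim: q => [|q IH]; first by rewrite muln0.
rewrite mulnSr mulSnr iotaD count_cat leq_add // count_pattern_block // => j jr.
have : p * j + p <= p * r by rewrite addnC -mulnS leq_mul2l jr orbT.
lia.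
Qed.

(** Offsets within a period are 0 modulo p for c = r, where nothing is shifted, and 1 modulo p for c
    = 0. *)
Lemma pattern_shift_disjoint (p r x : nat) :
  1 < p -> pattern p r r x -> ~~ pattern p r 0 x.
Proof.
move=> p1 /patternP[j jr xj]; apply/hasPn => j' _.
rewrite xj leqNgt jr /= addn0; apply/eqP => /(congr1 (modn^~ p)).
by rewrite mulnC modnMl mulnC modnMDl modn_small.
Qed.

(** By [ms] and [sm], s is m / p rounded up; q r + s turns out to be the maximal weight and the
    radius. *)
Section Center.
Variables (p r q m s : nat).
Hypotheses (p1 : 1 < p) (sr : s <= r) (ms : m <= p * s).
Hypothesis sm : forall j, j < s -> p * j < m.
Let n := (p * r + 1) * q + m.
Let p0 : 0 < p := ltnW p1.
Implicit Types u v : og_vertex p r n.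

Let mL : m <= p * r + 1.
Proof. by have : p * s <= p * r; [rewrite leq_mul2l sr orbT | lia]. Qed.

Lemma exists_pattern_vertex c :
  exists u, forall x, ones u x = (x < n) && pattern p r c x.
Proof. by apply: exists_vertex => //; exact: admissible_pattern. Qed.

Lemma count_pattern_vertex c u :
    (forall x, ones u x = (x < n) && pattern p r c x) ->
  count (ones u) (iota 0 n) = count (pattern p r c) (iota 0 n).
Proof.
by move=> uE; apply: eq_in_count => x; rewrite mem_iota /= uE => ->.
Qed.

Lemma weight_le u : count (ones u) (iota 0 n) <= q * r + s.
Proof. exact: count_le_max_weight (admissible_ones u p0) ms. Qed.

(** The unshifted pattern, c = r, already has weight q r + s, and a union with v only adds to it. *)
Lemma ecc_ge v : q * r + s <= eccentricity (@og_adj p r n) v.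
Proof.
have [u uE] := exists_pattern_vertex r.
apply: leq_trans (count_union_le_ecc u v p0).
apply: (@leq_trans (count (ones u) (iota 0 n))).
  rewrite (count_pattern_vertex uE) count_pattern // => j js.
  by rewrite [r <= j]leqNgt (leq_trans js) // addn0 sm.
by apply: sub_count => x /= ->.
Qed.

Lemma ecc_gt u v x : q * r + s <= count (ones u) (iota 0 n) ->
  ones v x -> ~~ ones u x -> q * r + s < eccentricity (@og_adj p r n) v.
Proof.
move=> hu vx nux; apply: leq_trans (count_union_le_ecc u v p0).
have xn := ones_lt vx.
apply: leq_ltn_trans hu _; rewrite -addn1.
have <- : count (pred1 x) (iota 0 n) = 1.
  by rewrite count_uniq_mem ?iota_uniq // mem_iota xn.
rewrite -count_predUI [X in _ + X](eq_count (a2 := pred0)) ?count_pred0 ?addn0.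
  by apply: sub_count => y /= /orP[->|/eqP->] //; rewrite vx orbT.
by move=> y /=; rewrite andbC; case: eqP => //= ->; apply/negbTE.
Qed.

Lemma ecc_zero v : ones v =1 pred0 ->
  eccentricity (@og_adj p r n) v = q * r + s.
Proof.
move=> v0; apply/eqP; rewrite eqn_leq ecc_ge andbT; apply/ecc_leP => // u.
apply: leq_trans (weight_le u); apply: sub_count => x.
by rewrite v0 /=; case: (ones u x).
Qed.

Lemma exists_zero_vertex : exists v, ones v =1 pred0.
Proof.
have [|v vE] := @exists_vertex p r n pred0 p0; last first.
  by exists v => x; rewrite vE andbF.
by split=> // x /(_ 0 isT).
Qed.

Lemma og_radius_eq : og_radius p r n = q * r + s.
Proof.
have [z /ecc_zero zE] := exists_zero_vertex.
exact: radius_eq ecc_ge zE.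
Qed.

Lemma in_og_center v :
  (v \in og_center p r n) = (eccentricity (@og_adj p r n) v <= q * r + s).
Proof. by rewrite inE -/(og_radius p r n) og_radius_eq eqn_leq ecc_ge andbT. Qed.

(** The hypothesis leaves room for the pattern with c = 0 to reach full weight too. It is disjoint
    from the one with c = r, so any one of v is missed by a word of maximal weight. *)
Lemma in_og_center_zero : (forall j, j < s -> p * j + 1 < m) ->
  forall v, v \in og_center p r n <-> ones v =1 pred0.
Proof.
move=> sm1 v; rewrite in_og_center; split=> [vc x|/ecc_zero -> //].
apply/negbTE/negP => vx; move: vc; rewrite leqNgt => /negP[].
have [u uE] := exists_pattern_vertex r.
have [u' uE'] := exists_pattern_vertex 0.
case: (boolP (ones u x)) => ux; last first.
  apply: ecc_gt vx ux; rewrite (count_pattern_vertex uE) count_pattern // => j js.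
  by rewrite [r <= j]leqNgt (leq_trans js) // addn0 sm.
apply: (ecc_gt (u := u') _ vx).
  by rewrite (count_pattern_vertex uE') count_pattern.
move: ux; rewrite uE uE' => /andP[-> /(pattern_shift_disjoint p1)] //.
Qed.

End Center.

Lemma in_og_center_critical (p r q k : nat)
    (v : og_vertex p r ((p * r + 1) * q + (p * k + 1))) : 1 < p -> k < r ->
  v \in og_center p r ((p * r + 1) * q + (p * k + 1)) <->
  ones v =1 pred0 \/
  exists i j, [/\ i <= q, j <= k & ones v =1 pred1 ((p * r + 1) * i + p * j)].
Proof.
move=> p1 kr; have p0 := ltnW p1.
have kr' : k + 1 <= r by rewrite addn1.
have ms : p * k + 1 <= p * (k + 1) by rewrite mulnDr muln1 leq_add2l.
have sm j : j < k + 1 -> p * j < p * k + 1.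
  by rewrite !addn1 !ltnS leq_mul2l => ->; rewrite orbT.
have mL : p * k + 1 < p * r + 1.
  by rewrite ltn_add2r ltn_pmul2l.
rewrite (in_og_center p1 kr' ms sm); split=> [vc|[v0|[i [j [iq jk vE]]]]].
- have crit x : ones v x ->
      pattern p r r x /\
      exists i j, [/\ i <= q, j <= k & x = (p * r + 1) * i + p * j].
    move=> vx; have xn := ones_lt vx.
    (* A pattern with no shift at indices up to k has maximal weight q r + k + 1, so a central v has
       all its ones inside it. *)
    have in_pattern c : (forall j, j < k + 1 -> (c <= j) = false) ->
        pattern p r c x.
      move=> ck; have [u uE] := exists_pattern_vertex r q (p * k + 1) p1 c.
      case: (boolP (ones u x)); first by rewrite uE => /andP[].
      move=> nux; suff : k + 1 + q * r < k + 1 + q * r by rewrite ltnn.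
      rewrite ![k + 1 + _]addnC; apply: leq_trans vc.
      apply: (ecc_gt p1 (u := u) _ vx nux).
      rewrite (count_pattern_vertex uE) count_pattern // ?(ltnW mL) // => j js.
      by rewrite ck // addn0 sm.
    have Pr : pattern p r r x.
      by apply: in_pattern => j js; rewrite leqNgt (leq_trans js).
    split=> //; case/patternP: (Pr) => j jr; rewrite leqNgt jr addn0 => xj.
    exists (x %/ (p * r + 1)), j; split.
    + rewrite -ltnS ltn_divLR ?addn1 // mulSnr mulnC -!(addn1 (p * r)).
      by apply: leq_trans xn _; rewrite leq_add2l ltnW.
    (* For c = k + 1 the ones of index above k are moved off the multiples of p, so x, at offset p
       j, has index at most k. *)
    + have /patternP[j' jr'] : pattern p r k.+1 x.
        by apply: in_pattern => j'; rewrite addn1 ltnS ltnNge => ->.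
      rewrite xj; case: (ltnP k j') => [kj' /= /(congr1 (modn^~ p))|j'k /=].
        by rewrite mulnC modnMl mulnC modnMDl modn_small.
      by rewrite addn0 => /eqP; rewrite eqn_pmul2l // => /eqP ->.
    + by rewrite {1}(divn_eq x (p * r + 1)) xj mulnC.
  (* The pattern with c = 0 has weight at least q r + k and misses every one of v, so centrality
     allows v at most a single one. *)
  have [u uE] := exists_pattern_vertex r q (p * k + 1) p1 0.
  have := leq_trans (count_union_le_ecc u v p0) vc.
  have := count_predUI (ones u) (ones v) (iota 0 ((p * r + 1) * q + (p * k + 1))).
  rewrite [X in _ + X](eq_count (a2 := pred0)); last first.
    move=> x /=; rewrite andbC; case vx: (ones v x) => //=.
    have [Pr _] := crit x vx.
    by rewrite uE (negbTE (pattern_shift_disjoint p1 Pr)) andbF.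
  rewrite count_pred0 addn0 => -> hv.
  have hu : q * r + k <=
      count (ones u) (iota 0 ((p * r + 1) * q + (p * k + 1))).
    rewrite (count_pattern_vertex uE) count_pattern // ?(ltnW kr) ?(ltnW mL) //.
    move=> j jk; have : p * j + p <= p * k by rewrite addnC -mulnS leq_mul2l jk orbT.
    by lia.
  have v1 : count (ones v) (iota 0 ((p * r + 1) * q + (p * k + 1))) <= 1 by lia.
  case: (boolP (has (ones v) (iota 0 ((p * r + 1) * q + (p * k + 1))))).
    move=> /hasP[x]; rewrite mem_iota => /= xn vx; right.
    have [_ [i [j [iq jk xE]]]] := crit x vx; exists i, j; split=> // y.
    rewrite -xE /=; apply/idP/eqP => [vy|-> //]; apply/eqP/negPn/negP => yx.
    have yn := ones_lt vy.
    have := @uniq_leq_size _ [:: y; x]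
      (filter (ones v) (iota 0 ((p * r + 1) * q + (p * k + 1)))).
    rewrite size_filter /= inE yx => /(_ isT) h; have : 1 < 1; last by [].
    apply: leq_trans v1; apply: h => z; rewrite !inE mem_filter mem_iota /=.
    by move=> /orP[]/eqP->; rewrite ?vy ?vx.
  move=> /hasPn v0; left => x; apply/negbTE/negP => vx.
  by have := v0 x; rewrite mem_iota (ones_lt vx) vx => /(_ isT).
- by rewrite (ecc_zero p1 kr' ms sm v0).
(* If u contains the one of v, the distance is at most the weight of u; otherwise u has weight at
   most q r + k and v contributes one more. *)
apply/ecc_leP => // u; case ux: (ones u ((p * r + 1) * i + p * j)).
  apply: leq_trans (weight_le p1 ms u); apply: sub_count => x.
  by rewrite /= vE /=; case: (x =P _) => [->|_]; rewrite ?ux //; case: (ones u x).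
have h := count_le_zero_at_critical (admissible_ones u p0) iq jk (negbT ux).
rewrite [q * r + _]addnA; apply: leq_trans (leq_add h (leqnn 1)).
apply: (@leq_trans (count (ones u) (iota 0 ((p * r + 1) * q + (p * k + 1))) +
  count (pred1 ((p * r + 1) * i + p * j)) (iota 0 ((p * r + 1) * q + (p * k + 1))))).
  rewrite -count_predUI; apply: leq_trans (leq_addr _ _).
  by apply: sub_count => x; rewrite /= vE /=; case: (x =P _) => _; case: (ones u x).
by rewrite leq_add2l count_uniq_mem ?iota_uniq // leq_b1.
Qed.

(** * The words of the center *)

Lemma word_of_ones (p r n : nat) (v : og_vertex p r n) (P : pred nat) :
  (forall x, x < n -> ones v x = P x) -> tval (val v) = mkseq P n.
Proof.
move=> vP; apply: (@eq_from_nth _ false); rewrite size_tuple ?size_mkseq //.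
by move=> x xn; rewrite nth_mkseq // -vP.
Qed.

Lemma mkseq_pred0 (n : nat) : mkseq pred0 n = zeros n.
Proof.
apply: (@eq_from_nth _ false); first by rewrite size_mkseq size_nseq.
by move=> i; rewrite size_mkseq => h; rewrite nth_mkseq // nth_nseq h.
Qed.

Lemma zeros_cat_mkseq_pred1 (a n x : nat) :
  zeros a ++ mkseq (pred1 x) n = mkseq (pred1 (a + x)) (a + n).
Proof.
rewrite -mkseq_pred0 /mkseq iotaD map_cat add0n; congr cat.
  by apply/eq_in_map => i; rewrite mem_iota /= => h; apply/esym/negbTE; lia.
rewrite -[in RHS](addn0 a) iotaDl -map_comp; apply: eq_map => i /=.
by rewrite addn0 eqn_add2l.
Qed.

Lemma mkseq_pred1_cat_zeros (a n x : nat) :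
  x < n -> mkseq (pred1 x) n ++ zeros a = mkseq (pred1 x) (n + a).
Proof.
move=> xn; rewrite -mkseq_pred0 /mkseq iotaD map_cat add0n; congr cat.
rewrite -[in RHS](addn0 n) iotaDl -map_comp; apply: eq_map => i /=.
by apply/esym/negbTE; lia.
Qed.

Definition critical_words (p r n q k : nat) : seq (seq bool) :=
  [seq mkseq (pred1 ((p * r + 1) * i + p * j)) n
    | i <- iota 0 q.+1, j <- iota 0 k.+1].

Lemma critical_wordsP (p r n q k : nat) (w : seq bool) :
  reflect (exists i j, [/\ i <= q, j <= k &
             w = mkseq (pred1 ((p * r + 1) * i + p * j)) n])
          (w \in critical_words p r n q k).
Proof.
apply: (iffP allpairsP) => [[[i j] []]|[i [j [iq jk ->]]]].
  by rewrite !mem_iota => iq jk ->; exists i, j.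
by exists (i, j); rewrite !mem_iota.
Qed.

Lemma critical_lt (p r q k i j : nat) : i <= q -> j <= k ->
  (p * r + 1) * i + p * j < (p * r + 1) * q + (p * k + 1).
Proof.
move=> iq jk; rewrite addnA [ltnRHS]addn1 ltnS.
by apply: leq_add; rewrite leq_mul2l ?iq ?jk orbT.
Qed.

(** The position of the one recovers i and j by division with remainder, since p j < p r + 1. *)
Lemma uniq_critical_words (p r q k : nat) : 0 < p -> k < r ->
  uniq (critical_words p r ((p * r + 1) * q + (p * k + 1)) q k).
Proof.
move=> p0 kr; apply: allpairs_uniq; rewrite ?iota_uniq //.
move=> _ _ /allpairsP[[i j] [+ + ->]] /allpairsP[[i' j'] [+ + ->]].
rewrite !mem_iota !add0n !ltnS => /= iq jk iq' jk'.
move=> /(congr1 (nth false ^~ ((p * r + 1) * i + p * j))).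
rewrite !nth_mkseq ?critical_lt //= eqxx => /esym/eqP E.
have ltL x : x <= k -> p * x < p * r + 1.
  by move=> xk; rewrite addn1 ltnS leq_mul2l (leq_trans xk (ltnW kr)) orbT.
have L0 : 0 < p * r + 1 by rewrite addn1.
have ii : i = i'.
  have := congr1 (divn^~ (p * r + 1)) E.
  by rewrite /= !(mulnC (p * r + 1)) !divnMDl // !divn_small ?ltL // !addn0.
by move: E; rewrite ii => /addnI/eqP; rewrite eqn_pmul2l // => /eqP->.
Qed.

Lemma og_center_words_critical (p r n q k : nat) :
    1 < p -> k < r -> n = (p * r + 1) * q + (p * k + 1) ->
  og_center_words p r n =i zeros n :: critical_words p r n q k.
Proof.
move=> p1 kr ->; have p0 := ltnW p1; set n' := _ + _ => w.
rewrite inE; apply/imageP/orP => [[v /(in_og_center_critical _ p1 kr) vc ->]|].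
  case: vc => [v0|[i [j [iq jk vE]]]]; [left|right].
    by rewrite -mkseq_pred0 (word_of_ones (P := pred0)).
  apply/critical_wordsP; exists i, j; split=> //; exact: word_of_ones.
case=> [/eqP->|/critical_wordsP[i [j [iq jk ->]]]].
  have [v v0] := exists_zero_vertex r q (p * k + 1) p1.
  exists v; first by apply/in_og_center_critical => //; left.
  by rewrite -mkseq_pred0 -(word_of_ones (v := v)).
(* A single one is admissible: k < r gives r >= 1, so a forbidden run needs two ones. *)
have [|v vE] := @exists_vertex p r n' (pred1 ((p * r + 1) * i + p * j)) p0.
  split=> [x y /eqP-> /eqP->|x run]; first by rewrite ltnn.
  have /eqP := run 0 isT; have /eqP := run 1 (leq_ltn_trans (leq0n k) kr).
  lia.
exists v; last by rewrite -(word_of_ones (v := v)) // => x xn; rewrite vE xn.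
apply/in_og_center_critical => //; right; exists i, j; split=> // x.
by rewrite vE andbC /=; case: (x =P _) => //= ->; rewrite critical_lt.
Qed.

Lemma card_og_center_critical (p r n q k : nat) :
    1 < p -> k < r -> n = (p * r + 1) * q + (p * k + 1) ->
  #|og_center p r n| = (q + 1) * (k + 1) + 1.
Proof.
move=> p1 kr nE; have h := og_center_words_critical p1 kr nE.
rewrite -(size_image (fun v => tval (val v))) -/(og_center_words p r n).
have uw : uniq (og_center_words p r n).
  by rewrite map_inj_uniq ?enum_uniq // => u v /val_inj/val_inj.
have uc : uniq (zeros n :: critical_words p r n q k).
  rewrite cons_uniq nE uniq_critical_words ?(ltnW p1) // andbT.
  apply/negP => /critical_wordsP[i [j [iq jk]]].
  move=> /(congr1 (nth false ^~ ((p * r + 1) * i + p * j))).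
  by rewrite nth_mkseq ?critical_lt //= nth_nseq eqxx critical_lt.
rewrite (perm_size (uniq_perm uw uc h)).
rewrite -[size _]/(size (critical_words p r n q k)).+1.
by rewrite size_allpairs !size_iota !addn1.
Qed.

(** A leading period of zeros raises i by one and a trailing one keeps it: the former reaches i = 1,
    ..., q + 1, the latter supplies i = 0. *)
Lemma critical_words_rec (p r n q k : nat) :
    k < r -> n = (p * r + 1) * q + (p * k + 1) ->
  zeros ((p * r + 1) + n) :: critical_words p r ((p * r + 1) + n) q.+1 k =i
    [seq zeros (p * r + 1) ++ c | c <- zeros n :: critical_words p r n q k] ++
    [seq c ++ zeros (p * r + 1) | c <- zeros n :: critical_words p r n q k].
Proof.
move=> kr nE w.
have lt_n i j : i <= q -> j <= k -> (p * r + 1) * i + p * j < n.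
  by move=> iq jk; rewrite nE critical_lt.
rewrite mem_cat; apply/idP/orP.
  rewrite inE => /orP[/eqP->|/critical_wordsP[i [j [iq jk ->]]]].
    by left; rewrite /= /zeros nseqD mem_head.
  case: i iq => [|i] iq.
    right; apply/mapP; exists (mkseq (pred1 ((p * r + 1) * 0 + p * j)) n).
      by rewrite inE; apply/orP; right; apply/critical_wordsP; exists 0, j.
    by rewrite mkseq_pred1_cat_zeros ?lt_n // [n + _]addnC.
  left; apply/mapP; exists (mkseq (pred1 ((p * r + 1) * i + p * j)) n).
    by rewrite inE; apply/orP; right; apply/critical_wordsP; exists i, j.
  by rewrite zeros_cat_mkseq_pred1 mulnS addnA.
case=> /mapP[c]; rewrite inE;
  move=> /orP[/eqP-> ->|/critical_wordsP[i [j [iq jk ->]]] ->].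
- by rewrite /zeros -nseqD mem_head.
- rewrite inE; apply/orP; right.
  apply/critical_wordsP; exists i.+1, j; split=> //.
  by rewrite zeros_cat_mkseq_pred1 mulnS addnA.
- by rewrite /zeros -nseqD [n + _]addnC mem_head.
rewrite inE; apply/orP; right.
apply/critical_wordsP; exists i, j; split=> //; first exact: leqW.
by rewrite mkseq_pred1_cat_zeros ?lt_n // [n + _]addnC.
Qed.

Lemma og_center_words_zero (p r n q m s : nat) :
    1 < p -> s <= r -> m <= p * s -> (forall j, j < s -> p * j + 1 < m) ->
    n = (p * r + 1) * q + m ->
  og_center_words p r n =i [:: zeros n].
Proof.
move=> p1 sr ms sm1 -> w; rewrite inE.
have sm j (js : j < s) : p * j < m by have := sm1 j js; lia.
have cP := in_og_center_zero (q := q) p1 sr ms sm sm1.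
apply/imageP/eqP => [[v /cP v0 ->]|->].
  by rewrite -mkseq_pred0 (word_of_ones (P := pred0)).
have [v v0] := exists_zero_vertex r q m p1.
exists v; first exact/cP.
by rewrite -mkseq_pred0 -(word_of_ones (v := v)).
Qed.

(** Once q r is split off, the claim is (s - 1)(p r + 1) < m r <= s (p r + 1), which follows from p
    (s - 1) < m <= p s and s <= r. *)
Lemma ceil_weight (p r q m s : nat) :
    0 < p -> s <= r -> m <= p * s -> p * s < m + p ->
    0 < (p * r + 1) * q + m ->
  Num.ceil ((((p * r + 1) * q + m) * r)%:R / (p * r + 1)%:R : rat)%R =
    Posz (q * r + s).
Proof.
move=> p0 sr ms sm n0; apply: Num.Theory.ceil_def.
have L0 : (0 < (p * r + 1)%:R :> rat)%R by rewrite Num.Theory.ltr0n addn1.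
rewrite Num.Theory.ltr_pdivlMr // Num.Theory.ler_pdivrMr //.
have -> : (((Posz (q * r + s) - 1)%:~R : rat) =
    (q * r + s)%:R - 1)%R by rewrite GRing.rmorphB.
rewrite -pmulrn GRing.mulrBl GRing.mul1r Num.Theory.ltrBlDr -!GRing.natrM.
rewrite -!GRing.natrD !Num.Theory.ltr_nat !Num.Theory.ler_nat.
have h1 := leq_mul sm (leqnn r).
have h2 := leq_mul ms (leqnn r).
apply/andP; split; nia.
Qed.

Theorem theorem4p2 (p r n : nat) (hp : 2 <= p) (hr : 1 <= r) (hn : 1 <= n) :
  [/\ Posz (og_radius p r n) =
        Num.ceil ((n * r)%:R / (p * r + 1)%:R : rat)%R,
      (forall k : nat, n %% (p * r + 1) <> k * p + 1) ->
        og_center_words p r n =i [:: zeros n]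
    & forall k : nat, n %% (p * r + 1) = k * p + 1 ->
        #|og_center p r n| = (n %/ (p * r + 1) + 1) * (k + 1) + 1 /\
        (p * r + 1 < n ->
         og_center_words p r n =i
           [seq zeros (p * r + 1) ++ c
             | c <- og_center_words p r (n - (p * r + 1))] ++
           [seq c ++ zeros (p * r + 1)
             | c <- og_center_words p r (n - (p * r + 1))])].
Proof.
have p0 := ltnW hp; set m := n %% (p * r + 1); set q := n %/ (p * r + 1).
have L0 : 0 < p * r + 1 by rewrite addn1.
have nE : n = (p * r + 1) * q + m by rewrite mulnC -divn_eq.
have mL : m <= p * r by rewrite -ltnS -[(p * r).+1]addn1 ltn_pmod.
(* This is m / p rounded up, the number of windows of length p that cover the remainder. *)
pose s := (m + p.-1) %/ p.
have sE := divn_eq (m + p.-1) p; have sm := ltn_pmod (m + p.-1) p0.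
have {sE sm}[ms ps] : m <= p * s /\ p * s < m + p.
  by rewrite -/s in sE; rewrite mulnC; split; lia.
have sr : s <= r.
  by rewrite -ltnS -(ltn_pmul2l p0) mulnS; apply: leq_trans ps _; lia.
have sm j : j < s -> p * j < m.
  move=> js; have : p * j + p <= p * s by rewrite addnC -mulnS leq_mul2l js orbT.
  by lia.
split.
- rewrite [in RHS]nE (ceil_weight p0 sr ms ps) -?nE //; congr Posz.
  by rewrite [in LHS]nE (og_radius_eq q hp sr ms sm).
(* Given p j < m, a failure of p j + 1 < m would mean m = j p + 1, the excluded case. *)
- move=> nk; apply: (og_center_words_zero hp sr ms _ nE) => j js.
  by have := sm j js; have := nk j; rewrite mulnC; lia.
move=> k; rewrite mulnC => mk.
have kr : k < r by rewrite -(ltn_pmul2l p0); lia.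
split; first by apply: (card_og_center_critical hp kr); rewrite -mk.
(* Since q >= 1, the shorter length has quotient q - 1 and the same k, so both centers are explicit
   lists. *)
move=> ltn; have q0 : 0 < q by rewrite divn_gt0 // ltnW.
have nE' : n - (p * r + 1) = (p * r + 1) * q.-1 + (p * k + 1).
  by rewrite {1}nE -{1}(prednK q0) mulnS -addnA addKn mk.
have cw := og_center_words_critical hp kr nE' => w.
rewrite (og_center_words_critical (q := q) hp kr) -?mk //.
rewrite -{1 2}(subnKC (ltnW ltn)) -(prednK q0) (critical_words_rec kr nE').
by rewrite !mem_cat; congr (_ || _); apply: eq_mem_map => x; rewrite cw.
Qed.
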